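(* Let $T_n^1$ and $T_n^2$ be two independent uniform attachment trees with $n$ vertices each, and let $X_n$ be the number of vertices of their largest common (unlabeled) subtree. For every $\varepsilon > 0$, $$\lim_{n\to\infty}\mathbb{P}\left(X_n \geq n^{2(\sqrt{2}-1)-\varepsilon}\right) = 1 .$$ In particular, $\lim_{n\to\infty}\mathbb{P}\left(X_n \geq n^{0.828}\right) = 1$.
   Context: A uniform attachment tree (random recursive tree) is defined recursively: $T_1$ is a single vertex, and given $T_n$, the tree $T_{n+1}$ is obtained by adding one new vertex and joining it by a single edge to a vertex of $T_n$ chosen uniformly at random, independently of everything else. For two finite trees $T^1,T^2$ (viewed as unlabeled, unrooted graphs), the size of their largest common subtree is the maximum of $|S|$ (number of vertices of $S$) over all trees $S$ such that $S$ is isomorphic to a subtree (connected subgraph) of $T^1$ and to a subtree of $T^2$; $X_n$ is this quantity for $T_n^1$ and $T_n^2$. *)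

(* Defs.v *)
From HB Require Import structures.
From mathcomp Require Import all_boot all_order all_algebra.
From mathcomp Require Import all_classical all_reals all_analysis.

Set Implicit Arguments.
Unset Strict Implicit.
Unset Printing Implicit Defensive.

Import Order.TTheory GRing.Theory Num.Theory.
Import numFieldNormedType.Exports.

Local Open Scope classical_set_scope.
Local Open Scope ring_scope.

(** * Finite simple graphs *)

Record graph := Graph {
  vertex :> finType;
  edge : rel vertex;
  edge_sym : symmetric edge;
  edge_irr : irreflexive edge }.

Definition isomorphic (G H : graph) : Prop :=
  exists f : G -> H, bijective f /\ forall x y, edge (f x) (f y) = edge x y.

Definition connected_graph (G : graph) : Prop :=
  (0 < #|G|)%N /\ forall x y : G, connect (@edge G) x y.

(* [ucycle] also accepts the degenerate closed walks [:: ] and [:: x; y];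
   a genuine cycle has at least three distinct vertices. *)
Definition acyclic_graph (G : graph) : Prop :=
  forall c : seq G, ucycle (@edge G) c -> (size c <= 2)%N.

Definition is_tree (G : graph) : Prop := connected_graph G /\ acyclic_graph G.

(* Subgraphs need not be induced. *)
Record subgraph (G : graph) := Subgraph {
  sub_vertex : {set G};
  sub_edge : rel G;
  sub_edge_sym : symmetric sub_edge;
  sub_edgeP : forall x y, sub_edge x y ->
    [/\ x \in sub_vertex, y \in sub_vertex & edge x y] }.

Section SubgraphGraph.
Variables (G : graph) (K : subgraph G).

Definition subgraph_rel : rel {x : G | x \in sub_vertex K} :=
  fun x y => sub_edge K (val x) (val y).

Lemma subgraph_rel_sym : symmetric subgraph_rel.
Proof. by move=> x y; apply: sub_edge_sym. Qed.

Lemma subgraph_rel_irr : irreflexive subgraph_rel.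
Proof.
by move=> x; apply/negP => /sub_edgeP[_ _]; rewrite edge_irr.
Qed.

Definition graph_of_subgraph : graph := Graph subgraph_rel_sym subgraph_rel_irr.

End SubgraphGraph.

Definition isomorphic_to_subtree (S G : graph) : Prop :=
  exists K : subgraph G, connected_graph (graph_of_subgraph K) /\
    isomorphic S (graph_of_subgraph K).

Definition common_subtree (S G H : graph) : Prop :=
  [/\ is_tree S, isomorphic_to_subtree S G & isomorphic_to_subtree S H].

(* A common subtree has at most #|G| vertices, so bounding the range of the
   maximum loses nothing. *)
Definition largest_common_subtree_size (G H : graph) : nat :=
  \max_(k < #|G|.+1 | `[< exists S : graph, common_subtree S G H /\ #|S| = k >])
    (k : nat).

(** * Uniform attachment trees *)

(* T_n has vertices 0, ..., n-1 in order of arrival. The tree T_{k+1}, with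
   vertices 0, ..., k, is extended by joining the new vertex k+1 to u k; thus
   u k is meant to satisfy u k <= k. *)
Definition attachment_rel (u : nat -> nat) (n : nat) : rel 'I_n :=
  fun x y => ((x < y)%N && (u y.-1 == x)) || ((y < x)%N && (u x.-1 == y)).

Lemma attachment_rel_sym u n : symmetric (@attachment_rel u n).
Proof. by move=> x y; rewrite /attachment_rel orbC. Qed.

Lemma attachment_rel_irr u n : irreflexive (@attachment_rel u n).
Proof. by move=> x; rewrite /attachment_rel ltnn. Qed.

Definition attachment_tree (u : nat -> nat) (n : nat) : graph :=
  Graph (@attachment_rel_sym u n) (@attachment_rel_irr u n).

Definition mutually_independent {d d' : measure_display}
    {Omega : measurableType d} {E : measurableType d'} {R : realType}
    (P : probability Omega R) (I : eqType) (X : I -> {RV P >-> E}) : Prop :=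
  forall (J : seq I) (A : I -> set E), uniq J ->
    (forall i, measurable (A i)) ->
    P [set w | forall i, i \in J -> A i (X i w)] =
    (\prod_(i <- J) P (X i @^-1` A i))%E.

(* The two attachment processes are indexed by the booleans: U (b, k) is the
   vertex, uniform on {0, ..., k}, to which vertex k+1 of tree b is joined.
   Joint independence of the whole family says both that every choice is made
   independently of the past and that the two trees are independent. *)
Definition independent_uniform_attachments {d : measure_display}
    {Omega : measurableType d} {R : realType} (P : probability Omega R)
    (U : bool * nat -> {RV P >-> nat}) : Prop :=
  mutually_independent U /\
  forall (b : bool) (k j : nat), (j <= k)%N ->
    distribution P (U (b, k)) [set j] = (k.+1%:R^-1)%:E.

(* Main.v *)
Require Import Defs.
From HB Require Import structures.
From mathcomp Require Import all_boot all_order all_algebra.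
From mathcomp Require Import all_classical all_reals all_analysis.
From mathcomp Require Import zify ring lra.

Set Implicit Arguments.
Unset Strict Implicit.
Unset Printing Implicit Defensive.

Import Order.TTheory GRing.Theory Num.Theory.
Import numFieldNormedType.Exports.

Local Open Scope classical_set_scope.
Local Open Scope ring_scope.

(** Order the children of every vertex by arrival. Each vertex of a uniform
    attachment tree then has an address, the sequence of the ranks met on the way
    down from the root, and the addresses occurring in both trees span a subtree
    of each. This common subtree is already large enough.

    The ordered tree is encoded by a binary tree whose leaves are the vertices:
    [Node l r] separates the subtree [l] of the first child of the root from
    the rest [r] of the tree, and attaching a new vertex to [v] replaces the
    leaf [v] by a node with the leaves of the new vertex and of [v]. In this
    encoding the number [common t t'] of shared addresses satisfies
      [common (Node l r) (Node l' r') = common l l' + common r r'],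
    with value 1 as soon as one of the trees is a leaf, and the size of [l] is
    uniform, [l] and [r] being independent uniform attachment trees given that
    size ([mean_split]).

    With [growth a k = (1 + a/1) ... (1 + a/k)], which is of order [k ^ a], the
    average of [growth a i] over [i <= k] is exactly [growth a k.+1 / (1 + a)].
    Follow the simultaneous splitting of two independent trees until one of
    them is a single vertex, and let each final pair of sizes [(i, j)] contribute
    [growth a i * growth b j]. The expectation of the total, [stopped_sum a b],
    is conserved when [(1 + a) * (1 + b) = 2]; for [a = b] this is
    [a = sqrt 2 - 1 = theta], the source of the exponent [2 * theta].
    Two facts turn this into a bound for [common]:
    - the second moment of [stopped_sum theta theta] is at most 3/2 times the
      square of its mean, so that this sum is comparable to its mean with
      probability bounded below ([second_moment_bound]);
    - the final pairs with one large size contribute little. They are compared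
      with the tilted sums for [a = theta - tau + tau ^ 2], [b = theta + tau],
      whose mean exceeds the one for [theta] by a factor of only [N ^ (tau ^ 2)],
      while a size above [N ^ eps] gains a factor [N ^ (eps * tau)].
    Hence [common >= N ^ s] with probability at least 1/6 for trees of sizes
    comparable to [N], for every [s < 2 * theta]
    ([common_large_positive_probability]).

    Finally the failure probability is squared by one more split: both halves of
    the two trees keep sizes comparable to [N] with probability close to 1, and
    the independent halves must both fail. A bound [x] for the limiting failure
    probability therefore improves to [x ^ 2], and it tends to 0
    ([small_bounded_by_pos]). *)

(** * Ordered attachment trees as binary trees, and their common subtree *)

Inductive btree (A : Type) :=
| Leaf of A
| Node of btree A & btree A.

Fixpoint nodes (A : Type) (t : btree A) : nat :=
  if t is Node l r then (nodes l + nodes r).+1 else 0.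

Fixpoint common (A B : Type) (t : btree A) (t' : btree B) : nat :=
  match t, t' with
  | Node l r, Node l' r' => common l l' + common r r'
  | _, _ => 1
  end.

Notation shape_tree := (btree unit).

Section CommonSubtree.
Local Open Scope nat_scope.

Fixpoint leaves (A : Type) (t : btree A) : seq A :=
  match t with Leaf a => [:: a] | Node l r => leaves l ++ leaves r end.

Fixpoint unlabel (A : Type) (t : btree A) : shape_tree :=
  match t with Leaf _ => Leaf tt | Node l r => Node (unlabel l) (unlabel r) end.

Fixpoint root_label (t : btree nat) : nat :=
  match t with Leaf a => a | Node _ r => root_label r end.

(** A matched pair consists of the two vertices with a given address; where one
    tree is exhausted, the other is represented by its root, the last leaf. *)
Fixpoint matched (t t' : btree nat) : seq (nat * nat) :=
  match t, t' with
  | Node l r, Node l' r' => matched l l' ++ matched r r'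
  | _, _ => [:: (root_label t, root_label t')]
  end.

Fixpoint grow (v w : nat) (t : btree nat) : btree nat :=
  match t with
  | Leaf a => if a == v then Node (Leaf w) (Leaf a) else Leaf a
  | Node l r => Node (grow v w l) (grow v w r)
  end.

(** The encoding of the tree on [k.+1] vertices in which vertex [j.+1] is
    joined to [u j]. *)
Fixpoint build (u : nat -> nat) (k : nat) : btree nat :=
  if k is k'.+1 then grow (u k') k'.+1 (build u k') else Leaf 0.

(** The invariant that the binary tree encodes the parent function [u]: at
    each node, the root of the left part is a child of the root of the right
    part. *)
Fixpoint attached (u : nat -> nat) (t : btree nat) : bool :=
  match t with
  | Leaf _ => true
  | Node l r => [&& 0 < root_label l, u (root_label l).-1 == root_label r,
                    attached u l & attached u r]
  end.

Lemma common_unlabel (A B : Type) (t : btree A) (t' : btree B) :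
  common (unlabel t) (unlabel t') = common t t'.
Proof. by elim: t t' => [a|l IHl r IHr] [b|l' r'] //=; rewrite IHl IHr. Qed.

Lemma size_matched t t' : size (matched t t') = common t t'.
Proof. by elim: t t' => [a|l IHl r IHr] [b|l' r'] //=; rewrite size_cat IHl IHr. Qed.

Lemma root_label_grow v w t : root_label (grow v w t) = root_label t.
Proof. by elim: t => [a|l _ r IH] //=; case: eqP. Qed.

Lemma root_label_build u k : root_label (build u k) = 0.
Proof. by elim: k => //= k IH; rewrite root_label_grow. Qed.

Lemma attached_grow u v w t : 0 < w -> u w.-1 = v ->
  attached u t -> attached u (grow v w t).
Proof.
move=> w0 uw; elim: t => [a _|l IHl r IHr] /=.
  by case: (eqVneq a v) => [->|//] /=; rewrite w0 uw eqxx.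
by case/and4P=> l0 lr hl hr; rewrite !root_label_grow l0 lr IHl ?IHr.
Qed.

Lemma attached_build u k : attached u (build u k).
Proof. by elim: k => //= k IH; apply: attached_grow. Qed.

Lemma root_label_leaves t : root_label t \in leaves t.
Proof. by elim: t => [a|l _ r IH] /=; rewrite ?mem_head// mem_cat IH orbT. Qed.

Lemma grow_notin v w t : v \notin leaves t -> grow v w t = t.
Proof.
elim: t => [a|l IHl r IHr] /=; first by rewrite inE eq_sym => /negPf->.
by rewrite mem_cat negb_or => /andP[/IHl-> /IHr->].
Qed.

Lemma leaves_grow v w t : uniq (leaves t) -> v \in leaves t ->
  perm_eq (leaves (grow v w t)) (w :: leaves t).
Proof.
elim: t => [a|l IHl r IHr] /=; first by rewrite inE eq_sym => _ ->.
rewrite cat_uniq => /and3P[ul /hasPn lr ur]; rewrite mem_cat.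
have [vl _|vl /= vr] := boolP (v \in leaves l).
  rewrite (@grow_notin _ _ r); last by apply: contraL vl => /lr.
  by rewrite -cat_cons perm_cat2r IHl.
rewrite (@grow_notin _ _ l)// -cat1s (perm_trans (y := leaves l ++ (w :: leaves r)))//.
  by rewrite perm_cat2l IHr.
by rewrite cat1s perm_catC /= perm_cons perm_catC.
Qed.

Lemma leaves_build u k : (forall j, j < k -> u j <= j) ->
  perm_eq (leaves (build u k)) (iota 0 k.+1).
Proof.
elim: k => [//|k IH] hu; have IHk := IH (fun j jk => hu j (ltnW jk)).
apply: (perm_trans (y := k.+1 :: leaves (build u k))).
  apply: leaves_grow; first by rewrite (perm_uniq IHk) iota_uniq.
  by rewrite (perm_mem IHk) mem_iota /= add0n ltnS hu.
by rewrite -[k.+2]addn1 iotaD add0n perm_sym perm_catC perm_cons perm_sym.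
Qed.

Lemma matched_root t t' : (root_label t, root_label t') \in matched t t'.
Proof.
elim: t t' => [a|l _ r IH] [b|l' r'] /=; rewrite ?mem_head//.
by rewrite mem_cat IH orbT.
Qed.

(** Matched vertices have matched parents: the root of a left part was paired
    with the root of a left part, and their parents are the roots of the right
    parts, which are paired as well. *)
Lemma matched_parent u u' t t' p : attached u t -> attached u' t' ->
  p \in matched t t' ->
  p = (root_label t, root_label t') \/
  [/\ 0 < p.1, 0 < p.2 & (u p.1.-1, u' p.2.-1) \in matched t t'].
Proof.
elim: t t' => [a|l IHl r IHr] [b|l' r'] /=; try by rewrite inE => _ _ /eqP; left.
case/and4P=> l0 /eqP lr hl hr /and4P[l0' /eqP lr' hl' hr'].
rewrite mem_cat => /orP[/(IHl l' hl hl')|/(IHr r' hr hr')].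
- case=> [->|[h1 h2 h3]]; right => /=; last by rewrite mem_cat h3.
  by split; rewrite // lr lr' mem_cat matched_root orbT.
- case=> [->|[h1 h2 h3]]; [left|right] => //.
  by rewrite mem_cat h3 orbT.
Qed.

Lemma unzip1_matched t t' : {subset unzip1 (matched t t') <= leaves t}.
Proof.
elim: t t' => [a|l IHl r IHr] [b|l' r'] x //=; rewrite ?inE.
  by move=> /eqP->; rewrite mem_cat root_label_leaves orbT.
by rewrite /unzip1 map_cat !mem_cat => /orP[/IHl->|/IHr->]; rewrite ?orbT.
Qed.

Lemma unzip2_matched t t' : {subset unzip2 (matched t t') <= leaves t'}.
Proof.
elim: t t' => [a|l IHl r IHr] [b|l' r'] x //=; rewrite ?inE.
  by move=> /eqP->; rewrite mem_cat root_label_leaves orbT.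
by rewrite /unzip2 map_cat !mem_cat => /orP[/IHl->|/IHr->]; rewrite ?orbT.
Qed.

Lemma uniq_unzip1_matched t t' : uniq (leaves t) -> uniq (unzip1 (matched t t')).
Proof.
elim: t t' => [a|l IHl r IHr] [b|l' r'] //=.
rewrite /unzip1 map_cat !cat_uniq => /and3P[/IHl-> /hasPn lr /IHr->].
rewrite andbT; apply/hasPn => x /unzip1_matched /lr; apply: contra.
exact: unzip1_matched.
Qed.

Lemma uniq_unzip2_matched t t' : uniq (leaves t') -> uniq (unzip2 (matched t t')).
Proof.
elim: t t' => [a|l IHl r IHr] [b|l' r'] //=.
rewrite /unzip2 map_cat !cat_uniq => /and3P[/IHl-> /hasPn lr /IHr->].
rewrite andbT; apply/hasPn => x /unzip2_matched /lr; apply: contra.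
exact: unzip2_matched.
Qed.

Section InducedSubgraph.
Variables (u : nat -> nat) (n : nat) (s : seq nat).

Definition induced_set : {set attachment_tree u n} := [set x : 'I_n | val x \in s].
Definition induced_edge : rel (attachment_tree u n) :=
  fun x y => [&& x \in induced_set, y \in induced_set & attachment_rel u x y].

Lemma induced_edge_sym : symmetric induced_edge.
Proof. by move=> x y; rewrite /induced_edge attachment_rel_sym andbCA. Qed.

Lemma induced_edgeP x y : induced_edge x y ->
  [/\ x \in induced_set, y \in induced_set & edge x y].
Proof. by case/and3P. Qed.

Definition induced : subgraph (attachment_tree u n) :=
  Subgraph induced_edge_sym induced_edgeP.

Notation G := (graph_of_subgraph induced).

Lemma in_induced (x : G) : nat_of_ord (val x) \in s.
Proof. by have := valP x; rewrite inE. Qed.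

Lemma edge_induced (x y : G) :
  edge x y = attachment_rel u (val x) (val y).
Proof. by rewrite /= /subgraph_rel /= /induced_edge !(valP x, valP y). Qed.

(** In a cycle, both neighbours of the latest vertex arrived earlier, hence both
    are its parent. *)
Lemma acyclic_induced : acyclic_graph G.
Proof.
move=> c /andP[cyc uc]; rewrite leqNgt; apply/negP => sc.
have [x xc] : exists x, x \in c by case: c sc {cyc uc} => // x c _; exists x; rewrite mem_head.
pose x0 := [arg max_(y > x in c) nat_of_ord (val y)].
have [x0c x0max] : x0 \in c /\ forall y, y \in c -> val y <= val x0.
  by rewrite /x0; case: arg_maxnP => // i ic imax; split=> // y /imax.
have nb y : y \in c -> edge x0 y -> u (val x0).-1 = val y.
  move=> /x0max h; rewrite edge_induced => /orP[/andP[]|/andP[_ /eqP//]].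
  by rewrite ltnNge h.
have [i c' rotc] := rot_to x0c.
have perm_c : c =i x0 :: c' by move=> y; rewrite -rotc mem_rot.
move: cyc uc sc; rewrite -(rot_cycle i) -(rot_uniq i) -(size_rot i) rotc {rotc}.
case: c' perm_c => [//|y c']; case/lastP: c' => [//|c' z] perm_c.
rewrite /= rcons_path last_rcons => /and3P[x0y _ zx0] /and3P[_ + _].
have yz : nat_of_ord (val y) = nat_of_ord (val z).
  have x0z : @edge G x0 z by rewrite edge_sym.
  rewrite -(nb y _ x0y) -?(nb z _ x0z)//.
  - by rewrite perm_c !inE mem_rcons mem_head !orbT.
  - by rewrite perm_c !inE eqxx orbT.
by rewrite (_ : y = z) ?mem_rcons ?mem_head//; apply/val_inj/val_inj.
Qed.

(** Following parents leads to vertex 0 inside a parent-closed set. *)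
Lemma connected_induced : 0 < n -> 0 \in s ->
  (forall a, a \in s -> 0 < a -> (u a.-1 \in s) && (u a.-1 < a)) -> 
  connected_graph G.
Proof.
move=> n0 s0 hs; have z0P : Ordinal n0 \in induced_set by rewrite inE.
pose z : G := exist (fun x => x \in induced_set) _ z0P.
have toz (x : G) : connect (@edge G) x z.
  have [m] := ubnP (nat_of_ord (val x)); elim: m x => // m IH x; rewrite ltnS => xm.
  have [x0|x0] := posnP (nat_of_ord (val x)).
    by rewrite (_ : x = z)//; apply/val_inj/val_inj.
  have /andP[ps px] := hs _ (in_induced x) x0.
  have pn : u (val x).-1 < n by rewrite (ltn_trans px)//.
  have pP : Ordinal pn \in induced_set by rewrite inE.
  pose y : G := exist (fun x => x \in induced_set) _ pP.
  apply: connect_trans (connect1 _) (IH y _); last exact: leq_trans px xm.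
  by rewrite edge_induced /attachment_rel px eqxx orbT.
split; first by apply/card_gt0P; exists z.
move=> x y; apply: connect_trans (toz x) _.
by rewrite (sym_connect_sym (@edge_sym G)).
Qed.

Lemma card_induced : uniq s -> {in s, forall a, a < n} -> #|G| = size s.
Proof.
move=> us sn; rewrite card_sig cardE.
rewrite -(size_map (@nat_of_ord n)); apply/perm_size/uniq_perm => //.
  by rewrite map_inj_uniq ?enum_uniq//; exact: val_inj.
move=> a; apply/mapP/idP => [[x]|sa].
  by rewrite mem_enum !inE => xs ->.
by exists (Ordinal (sn a sa)); rewrite ?mem_enum ?inE.
Qed.

End InducedSubgraph.

Lemma uniq_map_inj (T1 T2 : eqType) (f : T1 -> T2) (s : seq T1) :
  uniq [seq f x | x <- s] -> {in s &, injective f}.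
Proof.
elim: s => // x s IH /= /andP[xs us] a b; rewrite !inE.
move=> /predU1P[->|sa] /predU1P[->|sb] // e; last exact: IH.
- by rewrite e map_f in xs.
- by rewrite -e map_f in xs.
Qed.

(** A matching that is injective on both sides and compatible with parents
    carries edges to edges in both directions, because an edge always joins a
    vertex to its parent. *)
Lemma matching_size_le (u u' : nat -> nat) (n : nat) (M : seq (nat * nat)) :
  0 < n ->
  (forall j, j < n.-1 -> u j <= j) -> (forall j, j < n.-1 -> u' j <= j) ->
  uniq (unzip1 M) -> uniq (unzip2 M) ->
  {in M, forall p, p.1 < n /\ p.2 < n} ->
  (0, 0) \in M ->
  {in M, forall p, p = (0, 0) \/
     [/\ 0 < p.1, 0 < p.2 & (u p.1.-1, u' p.2.-1) \in M]} ->
  size M <= largest_common_subtree_size (attachment_tree u n) (attachment_tree u' n).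
Proof.
move=> n0 hu hu' uM1 uM2 Mn M0 Mpar.
have parent_lt v (hv : forall j, j < n.-1 -> v j <= j) c : 0 < c -> c < n -> v c.-1 < c.
  by case: c => //= c _ cn; rewrite ltnS hv// -ltnS prednK.
pose K := @induced u n (unzip1 M); pose K' := @induced u' n (unzip2 M).
have in1 a : a \in unzip1 M -> exists b, (a, b) \in M.
  by move=> /mapP[[a' b] pM ->]; exists b.
have in2 b : b \in unzip2 M -> exists a, (a, b) \in M.
  by move=> /mapP[[a b'] pM ->]; exists a.
have conK : connected_graph (graph_of_subgraph K).
  apply: connected_induced => //; first by apply/mapP; exists (0, 0).
  move=> a /in1[b abM] a0; have [/= an _] := Mn _ abM.
  have [[a00]|[_ _ /= h]] := Mpar _ abM; first by rewrite a00 in a0.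
  apply/andP; split; first by apply/mapP; eexists; first exact: h.
  exact: (parent_lt _ _ _ _).
have conK' : connected_graph (graph_of_subgraph K').
  apply: connected_induced => //; first by apply/mapP; exists (0, 0).
  move=> b /in2[a abM] b0; have [_ /= bn] := Mn _ abM.
  have [[_ b00]|[_ _ /= h]] := Mpar _ abM; first by rewrite b00 in b0.
  apply/andP; split; first by apply/mapP; eexists; first exact: h.
  exact: (parent_lt _ _ _ _).
have cardK : #|graph_of_subgraph K| = size M.
  rewrite card_induced ?size_map// => a /in1[b /Mn[]//].
have cardK' : #|graph_of_subgraph K'| = size M.
  rewrite card_induced ?size_map// => b /in2[a /Mn[]//].
have fun1 a b b' : (a, b) \in M -> (a, b') \in M -> b = b'.
  by move=> h h'; have [] := uniq_map_inj uM1 h h' erefl.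
have fun2 a a' b : (a, b) \in M -> (a', b) \in M -> a = a'.
  by move=> h h'; have [] := uniq_map_inj uM2 h h' erefl.
have partner (x : graph_of_subgraph K) : exists y : graph_of_subgraph K',
    (nat_of_ord (val x), nat_of_ord (val y)) \in M.
  have [b xb] := in1 _ (in_induced x); have [_ /= bn] := Mn _ xb.
  have bP : Ordinal bn \in sub_vertex K'.
    by rewrite inE; apply/mapP; exists (nat_of_ord (val x), b).
  by exists (exist (fun x => x \in sub_vertex K') _ bP).
have [f fM] := boolp.choice partner.
have isoK : isomorphic (graph_of_subgraph K) (graph_of_subgraph K').
  exists f; split.
    apply: inj_card_bij; last by rewrite cardK cardK'.
    move=> x y fxy; apply/val_inj/val_inj; apply: fun2 (fM x) _.
    by rewrite fxy; exact: fM.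
  move=> x y; rewrite !edge_induced.
  have ax := fM x; have ay := fM y.
  have step a b a' b' : (a, b) \in M -> (a', b') \in M ->
      ((b < b') && (u' b'.-1 == b)) = ((a < a') && (u a'.-1 == a)).
    move=> abM abM'; have [/= an bn] := Mn _ abM'.
    have [[-> ->]//|[/= a0 b0 parM]] := Mpar _ abM'.
    have ua := parent_lt u hu a' a0 an.
    have ub := parent_lt u' hu' b' b0 bn.
    apply/andP/andP => -[_ /eqP e]; rewrite e in parM.
      by rewrite (fun2 _ _ _ abM parM) ua eqxx.
    by rewrite (fun1 _ _ _ abM parM) ub eqxx.
  by rewrite /attachment_rel !(step _ _ _ _ ax ay, step _ _ _ _ ay ax).
have cs : common_subtree (graph_of_subgraph K) (attachment_tree u n) (attachment_tree u' n).
  split; first by split=> //; exact: acyclic_induced.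
  - exists K; split=> //; exists id; split=> //; exact: (Bijective (g := id)).
  - by exists K'.
have Kn : size M < #|attachment_tree u n|.+1.
  by rewrite ltnS -cardK card_sig max_card.
rewrite /largest_common_subtree_size.
apply: (@leq_bigmax_cond _ _ (fun k : 'I__ => k : nat) (Ordinal Kn)).
by apply/asboolP; exists (graph_of_subgraph K).
Qed.

Lemma common_le_largest_common_subtree (u u' : nat -> nat) (k : nat) :
  (forall j, j < k -> u j <= j) -> (forall j, j < k -> u' j <= j) ->
  common (build u k) (build u' k) <=
  largest_common_subtree_size (attachment_tree u k.+1) (attachment_tree u' k.+1).
Proof.
move=> hu hu'; rewrite -size_matched.
have p1 := leaves_build hu; have p2 := leaves_build hu'.
have u1 : uniq (leaves (build u k)) by rewrite (perm_uniq p1) iota_uniq.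
have u2 : uniq (leaves (build u' k)) by rewrite (perm_uniq p2) iota_uniq.
have root := matched_root (build u k) (build u' k).
rewrite !root_label_build in root.
apply: matching_size_le => //.
- exact: uniq_unzip1_matched.
- exact: uniq_unzip2_matched.
- move=> p pM; split.
  + have /unzip1_matched : p.1 \in unzip1 (matched (build u k) (build u' k)) by exact: map_f.
    by rewrite (perm_mem p1) mem_iota.
  + have /unzip2_matched : p.2 \in unzip2 (matched (build u k) (build u' k)) by exact: map_f.
    by rewrite (perm_mem p2) mem_iota.
- move=> p pM.
  have [->|] := matched_parent (attached_build u k) (attached_build u' k) pM.
    by rewrite !root_label_build; left.
  by right.
Qed.

End CommonSubtree.

(** * Averages over attachment trees and the splitting identity *)

Fixpoint splits (t : shape_tree) : seq shape_tree :=
  match t with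
  | Leaf _ => [:: Node (Leaf tt) (Leaf tt)]
  | Node l r => [seq Node l' r | l' <- splits l] ++ [seq Node l r' | r' <- splits r]
  end.

Fixpoint shapes (k : nat) : seq shape_tree :=
  if k is k'.+1 then flatten [seq splits t | t <- shapes k'] else [:: Leaf tt].

(** [shapes k] lists the shape of every one of the [k!] attachment sequences of
    length [k], with repetitions, so this is an expectation. *)
Definition mean (R : realType) (k : nat) (F : shape_tree -> R) : R :=
  (k`!%:R)^-1 * \sum_(t <- shapes k) F t.

Lemma big_splits_Node (R : realType) (F : shape_tree -> R) l r :
  \sum_(t <- splits (Node l r)) F t =
  \sum_(l' <- splits l) F (Node l' r) + \sum_(r' <- splits r) F (Node l r').
Proof. by rewrite /= big_cat !big_map. Qed.

Lemma size_splits t : size (splits t) = (nodes t).+1.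
Proof.
elim: t => [a|l IHl r IHr] //=; rewrite size_cat !size_map IHl IHr; lia.
Qed.

Section Mean.
Variable R : realType.
Implicit Types (F G : shape_tree -> R) (k : nat).

Lemma mean0 F : mean 0 F = F (Leaf tt).
Proof. by rewrite /mean /= big_seq1 invr1 mul1r. Qed.

Lemma meanS k F :
  mean k.+1 F = k.+1%:R^-1 * mean k (fun t => \sum_(t' <- splits t) F t').
Proof.
rewrite /mean factS natrM invfM /= -mulrA; congr (_ * (_ * _)).
by rewrite big_flatten big_map.
Qed.

Lemma meanD k F G : mean k (fun t => F t + G t) = mean k F + mean k G.
Proof. by rewrite /mean big_split mulrDr. Qed.

Lemma meanZ k c F : mean k (fun t => c * F t) = c * mean k F.
Proof. by rewrite /mean -mulr_sumr mulrCA. Qed.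

Lemma mean_sum (I : Type) (s : seq I) k (F : I -> shape_tree -> R) :
  mean k (fun t => \sum_(i <- s) F i t) = \sum_(i <- s) mean k (F i).
Proof. by rewrite /mean exchange_big /= mulr_sumr. Qed.

Lemma mean_exchange k m (F : shape_tree -> shape_tree -> R) :
  mean k (fun t => mean m (F t)) = mean m (fun t' => mean k (F^~ t')).
Proof.
by rewrite /mean -!mulr_sumr exchange_big /= mulrCA.
Qed.

(* [shape_tree] has no decidable equality here, so the size of the members of
   [splits t] is read off through sums over it. *)
(** Sums are compared rather than members: [shape_tree] carries no equality
    test, so that [t' \in splits t] is not available. *)
Lemma eq_big_splits F G t :
  (forall t', nodes t' = (nodes t).+1 -> F t' = G t') ->
  \sum_(t' <- splits t) F t' = \sum_(t' <- splits t) G t'.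
Proof.
elim: t F G => [a|l IHl r IHr] F G FG; first by rewrite !big_seq1; apply: FG.
rewrite !big_splits_Node; congr (_ + _).
- by apply: IHl => l' hl; apply: FG; rewrite /= hl.
- by apply: IHr => r' hr; apply: FG; rewrite /= hr addnS.
Qed.

Lemma eq_mean k F G :
  (forall t, nodes t = k -> F t = G t) -> mean k F = mean k G.
Proof.
elim: k F G => [|k IH] F G FG; first by rewrite !mean0; apply: FG.
rewrite !meanS; congr (_ * _); apply: IH => t ht.
by apply: eq_big_splits => t'; rewrite ht; apply: FG.
Qed.

Lemma ler_mean k F G :
  (forall t, F t <= G t) -> mean k F <= mean k G.
Proof.
move=> FG; rewrite ler_wpM2l ?invr_ge0 ?ler0n//.
by apply: ler_sum => t _; apply: FG.
Qed.

Lemma mean_cst k (c : R) : mean k (fun=> c) = c.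
Proof.
elim: k c => [|k IH] c; first by rewrite mean0.
rewrite meanS (@eq_mean _ _ (fun=> k.+1%:R * c)); last first.
  move=> t ht; rewrite big_const_seq count_predT size_splits ht.
  by rewrite iter_addr_0 mulr_natl.
by rewrite IH mulKf // pnatr_eq0.
Qed.

(** The first subtree of a uniform attachment tree has uniform size, and given
    its size the two parts are independent uniform attachment trees. By
    induction: a new vertex falls into a left part of size [i.+1] (leaves) with
    weight [i.+1] and into the right part with weight [(k - i).+1], and the
    contributions to the left size [i] add up to [i + (k.+1 - i) = k.+1]. *)
Lemma mean_split k F :
  mean k.+1 F =
  k.+1%:R^-1 * \sum_(i < k.+1) mean i (fun l => mean (k - i) (fun r => F (Node l r))).
Proof.
elim: k F => [|k IH] F.
  by rewrite meanS mean0 /= big_seq1 big_ord1 subnn !mean0.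
rewrite meanS IH; congr (_ * _).
(* [D i] is the term of index [i] on the right-hand side. *)
pose D i := mean i (fun l => mean (k.+1 - i) (fun r => F (Node l r))).
have step (i : 'I_k.+1) :
    mean i (fun l => mean (k - i) (fun r => \sum_(t' <- splits (Node l r)) F t')) =
    i.+1%:R * D i.+1 + (k - i).+1%:R * D i.
  have ik : (i <= k)%N by rewrite -ltnS.
  under eq_mean do under eq_mean do rewrite big_splits_Node.
  under eq_mean do rewrite meanD.
  rewrite meanD; congr (_ + _).
    rewrite /D meanS mulrA divff ?pnatr_eq0// mul1r.
    by apply: eq_mean => l _; rewrite mean_sum subSS.
  rewrite -meanZ; apply: eq_mean => l _.
  by rewrite subSn// meanS mulrA divff ?pnatr_eq0// mul1r.
under eq_bigr do rewrite step.
rewrite big_split /= -[in RHS]/(\sum_(i < k.+2) D i).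
have A : \sum_(i < k.+1) i.+1%:R * D i.+1 = \sum_(i < k.+2) i%:R * D i.
  by rewrite [RHS]big_ord_recl mul0r add0r.
have B : \sum_(i < k.+1) (k - i).+1%:R * D i = \sum_(i < k.+2) (k.+1 - i)%:R * D i.
  rewrite [RHS]big_ord_recr /= subnn mul0r addr0; apply: eq_bigr => i _.
  by rewrite subSn // -ltnS.
rewrite A B -big_split mulr_sumr; apply: eq_bigr => i _ /=.
have ik : (i <= k.+1)%N by rewrite -ltnS.
by rewrite -mulrDl -natrD subnKC // mulrA mulVf ?mul1r // pnatr_eq0.
Qed.

Definition mean2 k m (F : shape_tree -> shape_tree -> R) : R :=
  mean k (fun t => mean m (F t)).

Implicit Types H : shape_tree -> shape_tree -> R.

Lemma mean2D k m H1 H2 :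
  mean2 k m (fun t t' => H1 t t' + H2 t t') = mean2 k m H1 + mean2 k m H2.
Proof. by rewrite /mean2 -meanD; apply: eq_mean => t _; rewrite meanD. Qed.

Lemma mean2Z k m c H : mean2 k m (fun t t' => c * H t t') = c * mean2 k m H.
Proof. by rewrite /mean2 -meanZ; apply: eq_mean => t _; rewrite meanZ. Qed.

Lemma mean2_cst k m (c : R) : mean2 k m (fun _ _ => c) = c.
Proof. by rewrite /mean2; under eq_mean do rewrite mean_cst; rewrite mean_cst. Qed.

Lemma eq_mean2 k m H1 H2 :
  (forall t t', nodes t = k -> nodes t' = m -> H1 t t' = H2 t t') ->
  mean2 k m H1 = mean2 k m H2.
Proof.
by move=> FG; apply: eq_mean => t ht; apply: eq_mean => t' ht'; apply: FG.
Qed.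

Lemma ler_mean2 k m H1 H2 :
  (forall t t', H1 t t' <= H2 t t') -> mean2 k m H1 <= mean2 k m H2.
Proof. by move=> FG; apply: ler_mean => t; apply: ler_mean => t'. Qed.

Implicit Types f g : nat -> nat -> R.

Definition avg2 k m f : R :=
  k.+1%:R^-1 * \sum_(i < k.+1) (m.+1%:R^-1 * \sum_(j < m.+1) f i j).

Lemma eq_avg2 k m f g :
  (forall i j, (i <= k)%N -> (j <= m)%N -> f i j = g i j) -> avg2 k m f = avg2 k m g.
Proof.
move=> fg; rewrite /avg2; congr (_ * _); apply: eq_bigr => i _.
by congr (_ * _); apply: eq_bigr => j _; apply: fg; rewrite -ltnS.
Qed.

Lemma ler_avg2 k m f g :
  (forall i j, (i <= k)%N -> (j <= m)%N -> f i j <= g i j) -> avg2 k m f <= avg2 k m g.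
Proof.
move=> fg; rewrite /avg2 ler_wpM2l ?invr_ge0//; apply: ler_sum => i _.
rewrite ler_wpM2l ?invr_ge0//; apply: ler_sum => j _.
by apply: fg; rewrite -ltnS.
Qed.

Lemma avg2D k m f g : avg2 k m (fun i j => f i j + g i j) = avg2 k m f + avg2 k m g.
Proof.
rewrite /avg2 -mulrDr -big_split; congr (_ * _); apply: eq_bigr => i _ /=.
by rewrite -mulrDr -big_split.
Qed.

Lemma avg2_prod k m (u v : nat -> R) :
  avg2 k m (fun i j => u i * v j) =
  (k.+1%:R^-1 * \sum_(i < k.+1) u i) * (m.+1%:R^-1 * \sum_(j < m.+1) v j).
Proof.
rewrite /avg2 -mulrA mulr_suml; congr (_ * _); apply: eq_bigr => i _.
by rewrite -mulr_sumr mulrCA.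
Qed.

Lemma avg2Z k m c f : avg2 k m (fun i j => c * f i j) = c * avg2 k m f.
Proof.
rewrite /avg2 mulrCA; congr (_ * _); rewrite mulr_sumr; apply: eq_bigr => i _.
by rewrite -mulr_sumr mulrCA.
Qed.

Lemma avg2_cst k m c : avg2 k m (fun _ _ => c) = c.
Proof.
have h n : n.+1%:R != 0 :> R by rewrite pnatr_eq0.
rewrite /avg2 !sumr_const !card_ord -[c *+ m.+1]mulr_natl mulKf //.
by rewrite -[c *+ k.+1]mulr_natl mulKf.
Qed.

Lemma avg2_rev k m f : avg2 k m (fun i j => f (k - i)%N (m - j)%N) = avg2 k m f.
Proof.
rewrite /avg2; congr (_ * _); rewrite [RHS](reindex_inj rev_ord_inj).
apply: eq_bigr => i _; congr (_ * _); rewrite [RHS](reindex_inj rev_ord_inj).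
by apply: eq_bigr => j _.
Qed.

Lemma mean2_split k m H :
  mean2 k.+1 m.+1 H =
  avg2 k m (fun i j => mean2 i j (fun l l' => mean2 (k - i) (m - j) (fun r r' =>
    H (Node l r) (Node l' r')))).
Proof.
rewrite /mean2 mean_split; congr (_ * _); apply: eq_bigr => i _.
under eq_mean do under eq_mean do rewrite mean_split.
under eq_mean do rewrite meanZ mean_sum.
rewrite meanZ mean_sum; congr (_ * _); apply: eq_bigr => j _.
by apply: eq_mean => l _; rewrite mean_exchange.
Qed.

(** By symmetry of the uniform split, the two branches contribute equally. *)
Lemma mean2_branch_sum k m H :
  avg2 k m (fun i j => mean2 i j (fun l l' => mean2 (k - i) (m - j) (fun r r' =>
      H l l' + H r r'))) =
  2 * avg2 k m (fun i j => mean2 i j H).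
Proof.
pose h i j := mean2 i j H.
rewrite mulr_natl mulr2n -{2}(avg2_rev _ _ h) -avg2D; apply: eq_avg2 => i j _ _.
under eq_mean2 do rewrite mean2D mean2_cst.
by rewrite mean2D mean2_cst.
Qed.

End Mean.

(** * Growth functions and the moments of stopped sums *)

Section Growth.
Variable R : realType.
Implicit Types a : R.

(** This is [Gamma (k + 1 + a) / (Gamma (k + 1) * Gamma (1 + a))], of order
    [k ^ a]. Unlike the power itself it is an exact eigenfunction of averaging
    over a uniform smaller size. *)
Definition growth a (k : nat) : R := \prod_(i < k) (1 + a / i.+1%:R).

Lemma growth0 a : growth a 0 = 1.
Proof. by rewrite /growth big_ord0. Qed.

Lemma growthS a k : growth a k.+1 = growth a k * (1 + a / k.+1%:R).
Proof. by rewrite /growth big_ord_recr. Qed.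

Lemma growth_ge1 a k : 0 <= a -> 1 <= growth a k.
Proof.
move=> a0; elim: k => [|k IH]; first by rewrite growth0.
by rewrite growthS mulr_ege1// lerDl divr_ge0.
Qed.

Lemma sum_growth a k :
  (1 + a) * \sum_(i < k.+1) growth a i = k.+1%:R * growth a k.+1.
Proof.
elim: k => [|k IH].
  by rewrite big_ord1 growthS growth0 divr1 mulr1 !mul1r.
rewrite big_ord_recr mulrDr IH [in RHS]growthS /=.
have h : 0 <= k.+1%:R :> R by rewrite ler0n.
rewrite -[k.+2]addn1 natrD; field; lra.
Qed.

(** [growth a] squared behaves like [growth (a *+ 2)], up to the term
    [a ^+ 2 / k.+1], which has the favourable sign. *)
Lemma sum_growth_sqr a k : 0 <= a ->
  (1 + a *+ 2) * \sum_(i < k.+1) growth a i ^+ 2 <= k.+1%:R * growth a k.+1 ^+ 2.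
Proof.
move=> a0; elim: k => [|k IH].
  rewrite big_ord1 growthS growth0 divr1 !mul1r expr1n mulr1 sqrrD expr1n mul1r.
  by rewrite lerDl sqr_ge0.
rewrite big_ord_recr mulrDr [in leRHS]growthS /=.
apply: (le_trans (lerD IH (lexx _))).
rewrite -mulrDl exprMn [leRHS]mulrCA [leLHS]mulrC ler_wpM2l ?sqr_ge0//.
have h : 0 <= k.+1%:R :> R by rewrite ler0n.
have -> : k.+2%:R * (1 + a / k.+2%:R) ^+ 2 =
   k.+1%:R + (1 + a *+ 2) + a ^+ 2 / k.+2%:R.
  rewrite -[k.+2]addn1 natrD; field; lra.
by rewrite lerDl divr_ge0// sqr_ge0.
Qed.

(** Bernoulli's inequality, obtained from Young's inequality for [x `^ a] and
    1 with conjugate exponents [a^-1] and [(1 - a)^-1]. *)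
Lemma powR_le_linear (x a : R) : 0 <= x -> 0 < a < 1 -> x `^ a <= 1 + a * (x - 1).
Proof.
move=> x0 /andP[a0 a1].
have := @conjugate_powR R (x `^ a) 1 a^-1 (1 - a)^-1.
rewrite !invrK -powRrM mulfV ?gt_eqF// powRr1// powR1 mulr1.
move=> /(_ (powR_ge0 _ _) ler01); rewrite !invr_gt0 subr_gt0.
move=> /(_ a0 a1); rewrite addrC subrK => /(_ erefl); lra.
Qed.

Lemma growth_ge_powR a k : 0 < a < 1 -> k.+1%:R `^ a <= growth a k.
Proof.
move=> a01; have /andP[a0 a1] := a01.
elim: k => [|k IH]; first by rewrite growth0 powR1.
have h : 0 < k.+1%:R :> R by rewrite ltr0n.
have -> : k.+2%:R = k.+1%:R * (1 + k.+1%:R^-1) :> R.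
  by rewrite mulrDr mulfV ?gt_eqF// mulr1 -natr1.
have h' : 0 <= 1 + k.+1%:R^-1 :> R by rewrite addr_ge0.
rewrite growthS powRM ?ler0n//.
apply: ler_pM => //; rewrite ?powR_ge0//.
have := @powR_le_linear (1 + k.+1%:R^-1) a _ a01.
rewrite [1 + _ - 1]addrC addKr; exact.
Qed.

Lemma growth_le_powR a k : 0 <= a -> growth a k <= expR a * k.+1%:R `^ a.
Proof.
move=> a0; have sharp j : growth a j.+1 <= expR a * j.+1%:R `^ a.
  elim: j => [|j IH]; first by rewrite growthS growth0 powR1 mulr1 mul1r divr1 expR_ge1Dx.
  rewrite growthS; apply: (le_trans (ler_wpM2r _ IH)).
    by rewrite addr_ge0// divr_ge0.
  rewrite -mulrA ler_wpM2l ?expR_ge0//.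
  rewrite /powR !pnatr_eq0 /=; apply: (le_trans (ler_wpM2l (expR_ge0 _) (expR_ge1Dx _))).
  rewrite -expRD ler_expR -mulrDr ler_wpM2l//.
  have h : 0 <= j%:R :> R by rewrite ler0n.
  have := @le_ln1Dx R (- j.+2%:R^-1).
  have -> : 1 - j.+2%:R^-1 = j.+1%:R / j.+2%:R :> R.
    rewrite -!natr1; field; lra.
  rewrite ln_div ?posrE ?ltr0n// ltrN2 invf_lt1 ?ltr0n// ltr1n => /(_ isT).
  by move: (ln j.+1%:R) (ln j.+2%:R) (j.+2%:R^-1) => x y z; lra.
apply: (le_trans _ (sharp k)).
rewrite growthS ler_peMr ?lerDl ?divr_ge0//.
by apply: le_trans (growth_ge1 k a0).
Qed.

End Growth.

Section StoppedSum.
Variable R : realType.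
Implicit Types a b : R.

(** The splitting stops where one of the two trees is a single vertex; [common]
    is the same sum with all contributions equal to 1. *)
Fixpoint stopped_sum a b (t t' : shape_tree) : R :=
  match t, t' with
  | Node l r, Node l' r' => stopped_sum a b l l' + stopped_sum a b r r'
  | _, _ => growth a (nodes t) * growth b (nodes t')
  end.

Lemma stopped_sum_boundary a b t t' : (nodes t == 0) || (nodes t' == 0) ->
  stopped_sum a b t t' = growth a (nodes t) * growth b (nodes t').
Proof. by case: t => [[]|l r]; case: t' => [[]|l' r']. Qed.

Lemma stopped_sum_ge0 a b t t' : 0 <= a -> 0 <= b -> 0 <= stopped_sum a b t t'.
Proof.
move=> a0 b0; elim: t t' => [x|l IHl r IHr] [y|l' r'];
  by rewrite ?addr_ge0 //= mulr_ge0// (le_trans ler01)// growth_ge1.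
Qed.

Lemma mean2_boundary k m H1 H2 : (k == 0) || (m == 0) ->
  (forall t t', (nodes t == 0) || (nodes t' == 0) ->
     H1 t t' = H2 (nodes t) (nodes t')) ->
  mean2 k m H1 = H2 k m :> R.
Proof.
move=> km h; rewrite (@eq_mean2 _ _ _ _ (fun _ _ => H2 k m)) ?mean2_cst//.
by move=> t t' kt mt'; rewrite h ?kt ?mt'.
Qed.

Lemma avg2_growth a b k m : 0 <= a -> 0 <= b ->
  (1 + a) * (1 + b) * avg2 k m (fun i j => growth a i * growth b j) =
  growth a k.+1 * growth b m.+1.
Proof.
move=> a0 b0; rewrite avg2_prod.
have S c n : (1 + c) * (n.+1%:R^-1 * \sum_(i < n.+1) growth c i) = growth c n.+1 :> R.
  by rewrite mulrCA sum_growth mulKf// pnatr_eq0.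
by rewrite -(S a) -(S b); ring.
Qed.

(** The product of the growth functions is superharmonic for the splitting: one
    step multiplies its expectation by [2 / ((1 + a) * (1 + b))]. *)
Lemma mean_stopped_sum_le a b k m : 0 <= a -> 0 <= b -> 2 <= (1 + a) * (1 + b) ->
  mean2 k m (stopped_sum a b) <= growth a k * growth b m.
Proof.
move=> a0 b0 ab; elim/ltn_ind: k m => -[|k] IH [|m];
  try by rewrite (@mean2_boundary _ _ _ (fun k m => growth a k * growth b m))//;
    exact: stopped_sum_boundary.
rewrite mean2_split mean2_branch_sum -avg2_growth//.
apply: (@le_trans _ _ (2 * avg2 k m (fun i j => growth a i * growth b j))).
  by rewrite ler_wpM2l//; apply: ler_avg2 => i j ik _; apply: IH.
rewrite ler_wpM2r//; rewrite -(avg2_cst k m 0); apply: ler_avg2 => i j _ _.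
by rewrite mulr_ge0// (le_trans ler01)// growth_ge1.
Qed.

Lemma mean_stopped_sum a k m : 0 <= a -> (1 + a) ^+ 2 = 2 ->
  mean2 k m (stopped_sum a a) = growth a k * growth a m.
Proof.
move=> a0 aa; elim/ltn_ind: k m => -[|k] IH [|m];
  try by rewrite (@mean2_boundary _ _ _ (fun k m => growth a k * growth a m))//;
    exact: stopped_sum_boundary.
rewrite mean2_split mean2_branch_sum -avg2_growth// -expr2 aa; congr (_ * _).
by apply: eq_avg2 => i j ik _; apply: IH.
Qed.

Lemma avg2_growth_sqr a k m : 0 <= a ->
  (1 + a *+ 2) ^+ 2 * avg2 k m (fun i j => (growth a i * growth a j) ^+ 2) <=
  (growth a k.+1 * growth a m.+1) ^+ 2.
Proof.
move=> a0; have S n :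
    0 <= (1 + a *+ 2) * (n.+1%:R^-1 * \sum_(i < n.+1) growth a i ^+ 2)
      <= growth a n.+1 ^+ 2.
  apply/andP; split.
    rewrite !mulr_ge0 ?invr_ge0// ?addr_ge0 ?mulrn_wge0//.
    by apply: sumr_ge0 => i _; exact: sqr_ge0.
  by rewrite mulrCA ler_pdivrMl ?ltr0n// sum_growth_sqr.
have /andP[Sk0 Sk1] := S k; have /andP[Sm0 Sm1] := S m.
rewrite (@eq_avg2 _ _ _ _ (fun i j => growth a i ^+ 2 * growth a j ^+ 2)); last first.
  by move=> i j _ _; rewrite exprMn.
rewrite avg2_prod exprMn; have := ler_pM Sk0 Sm0 Sk1 Sm1.
by congr (_ <= _); ring.
Qed.

(** The cross terms of the square of a split sum factor, by independence of the
    two branches, and are at most the sum of the squared means. If [h] bounds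
    the ratio of the second moment to the squared mean, one step yields the
    bound [2 * (h + 1) / (1 + 2 * a) ^ 2], which is at most [h] for [h = 3/2]
    because [(1 + 2 * a) ^ 2 >= 10/3] when [a = sqrt 2 - 1]. *)
Lemma mean_stopped_sum_sqr a k m : 0 <= a -> (1 + a) ^+ 2 = 2 ->
  mean2 k m (fun t t' => stopped_sum a a t t' ^+ 2) <=
  3 / 2 * (growth a k * growth a m) ^+ 2.
Proof.
move=> a0 aa; pose g i j := growth a i * growth a j.
have boundary i j : (i == 0)%N || (j == 0)%N ->
    mean2 i j (fun t t' => stopped_sum a a t t' ^+ 2) <= 3 / 2 * g i j ^+ 2.
  move=> ij; rewrite (@mean2_boundary _ _ _ (fun i j => g i j ^+ 2))//; last first.
    by move=> t t' tt'; rewrite stopped_sum_boundary.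
  by rewrite ler_peMl ?sqr_ge0//; lra.
elim/ltn_ind: k m => -[|k] IH [|m]; try exact: boundary.
have key i j : (i <= k)%N -> (j <= m)%N ->
    mean2 i j (fun l l' => mean2 (k - i) (m - j) (fun r r' =>
      (stopped_sum a a l l' + stopped_sum a a r r') ^+ 2)) <=
    5 / 2 * (g i j ^+ 2 + g (k - i)%N (m - j)%N ^+ 2).
  move=> ik jm.
  have -> : mean2 i j (fun l l' => mean2 (k - i) (m - j) (fun r r' =>
      (stopped_sum a a l l' + stopped_sum a a r r') ^+ 2)) =
    mean2 i j (fun t t' => stopped_sum a a t t' ^+ 2) +
    mean2 (k - i) (m - j) (fun t t' => stopped_sum a a t t' ^+ 2) +
    2 * (g i j * g (k - i)%N (m - j)%N).
    transitivity (mean2 i j (fun l l' => stopped_sum a a l l' ^+ 2 +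
      mean2 (k - i) (m - j) (fun t t' => stopped_sum a a t t' ^+ 2) +
      2 * g (k - i)%N (m - j)%N * stopped_sum a a l l')); last first.
      by rewrite !mean2D mean2_cst mean2Z mean_stopped_sum// mulrAC -mulrA.
    apply: eq_mean2 => l l' _ _; rewrite /g -(@mean_stopped_sum a (k - i))//.
    rewrite [2 * _ * _]mulrAC -mean2Z -[X in X + _ + _](mean2_cst (k - i) (m - j)) -!mean2D.
    by apply: eq_mean2 => r r' _ _; ring.
  have := IH i ik j; have := IH (k - i)%N (leq_subr _ _) (m - j)%N.
  rewrite -/(g i j) -/(g (k - i)%N (m - j)%N).
  have := sqr_ge0 (g i j - g (k - i)%N (m - j)%N); nra.
rewrite mean2_split; apply: le_trans (ler_avg2 key) _.
rewrite avg2Z avg2D (avg2_rev k m (fun i j => g i j ^+ 2)).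
have := avg2_growth_sqr k m a0; rewrite -/(g _ _).
have A0 : 0 <= avg2 k m (fun i j => g i j ^+ 2).
  by rewrite -(avg2_cst k m 0); apply: ler_avg2 => i j _ _; exact: sqr_ge0.
have a1 : a <= 5 / 12 by nra.
have a2 : 10 / 3 <= (1 + a *+ 2) ^+ 2 by rewrite mulr2n; nra.
rewrite -/(g k.+1 m.+1); nra.
Qed.

End StoppedSum.

(** * A large common subtree with positive probability *)

Section SecondMoment.
Variable R : realType.
Implicit Types a b A L : R.

(** Final pairs of small size are paid for by [A * common], the others by one
    of the two tilted sums, according to the tree that is not reduced to a
    vertex. *)
Lemma stopped_sum_le_common th a b A L (t t' : shape_tree) :
  0 <= A -> 0 <= L -> 0 <= a -> 0 <= b ->
  (forall k, growth th k <= A + L * growth b k) ->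
  stopped_sum th th t t' <=
  A * (common t t')%:R + L * (stopped_sum a b t t' + stopped_sum b a t t').
Proof.
move=> A0 L0 a0 b0 hb.
have leaf k : growth th k <= A * 1%:R + L * (growth a 0 * growth b k + growth b 0 * growth a k).
  apply: (le_trans (hb k)); rewrite mulr1 lerD2l ler_wpM2l// !growth0 !mul1r lerDl.
  by rewrite (le_trans ler01)// growth_ge1.
elim: t t' => [x|l IHl r IHr] [y|l' r'].
- by have := leaf 0; rewrite /= !growth0 !mul1r.
- by have := leaf (nodes l' + nodes r').+1; rewrite /= !growth0 !mul1r.
- have := leaf (nodes l + nodes r).+1; rewrite /= !growth0 !mul1r !mulr1.
  by rewrite [growth b _ + _]addrC.
rewrite /= natrD; have := IHl l'; have := IHr r'.
by rewrite !mulrDr => h1 h2; apply: le_trans (lerD h2 h1) _; rewrite le_eqVlt; apply/orP; left; apply/eqP; ring.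
Qed.

Definition small (y : R) (t t' : shape_tree) : R := (((common t t')%:R < y)%R : bool)%:R.

Lemma small_ge0 y t t' : 0 <= small y t t'.
Proof. by rewrite /small ler0n. Qed.

Lemma small_le1 y t t' : small y t t' <= 1.
Proof. by rewrite /small; case: ltP. Qed.

Lemma mean_small_le1 k m y : mean2 k m (small y) <= 1.
Proof.
by rewrite -[leRHS](mean2_cst k m); apply: ler_mean2 => t t'; exact: small_le1.
Qed.

Lemma mean_small_ge0 k m y : 0 <= mean2 k m (small y).
Proof.
by rewrite -[leLHS](mean2_cst k m); apply: ler_mean2 => t t'; exact: small_ge0.
Qed.

(** A Paley-Zygmund argument: [Z] has mean [g], but on the event [small] it is at
    most [g / 4 + B]. Bounding [Z] elsewhere by
    [Z ^ 2 / (6 g) + 3 g / 2] leaves at least [g / 4] for the complement of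
    [small], weighted by [3 g / 2]. *)
Lemma second_moment_bound k m g A y (Z B : shape_tree -> shape_tree -> R) :
  0 < g -> 0 <= A -> A * y <= g / 4 ->
  (forall t t', 0 <= B t t') ->
  (forall t t', Z t t' <= A * (common t t')%:R + B t t') ->
  mean2 k m Z = g -> mean2 k m (fun t t' => Z t t' ^+ 2) <= 3 / 2 * g ^+ 2 ->
  mean2 k m B <= g / 4 ->
  mean2 k m (small y) <= 5 / 6.
Proof.
move=> g0 A0 Ay B0 ZB EZ EZ2 EB.
have pt t t' : Z t t' <= (g / 4 + 3 / 2 * g) + B t t' + (6 * g)^-1 * Z t t' ^+ 2
                 + - (3 / 2 * g) * small y t t'.
  have AMGM : Z t t' <= (6 * g)^-1 * Z t t' ^+ 2 + 3 / 2 * g.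
    rewrite -subr_ge0.
    have -> : (6 * g)^-1 * Z t t' ^+ 2 + 3 / 2 * g - Z t t' = (6 * g)^-1 * (Z t t' - 3 * g) ^+ 2.
      by field; rewrite gt_eqF.
    by rewrite mulr_ge0 ?sqr_ge0// invr_ge0; lra.
  rewrite /small; case: ltP => h /=.
    have : A * (common t t')%:R <= A * y by rewrite ler_wpM2l// ltW.
    have := ZB t t'.
    have : 0 <= (6 * g)^-1 * Z t t' ^+ 2 by rewrite mulr_ge0 ?sqr_ge0// invr_ge0; lra.
    lra.
  have := B0 t t'; lra.
have := ler_mean2 k m pt; rewrite EZ !mean2D !mean2Z !mean2_cst.
have : (6 * g)^-1 * mean2 k m (fun t t' => Z t t' ^+ 2) <= g / 4.
  rewrite ler_pdivrMl; last by lra.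
  by apply: le_trans EZ2 _; rewrite le_eqVlt; apply/orP; left; apply/eqP; field.
move=> h1 h2; have : 3 / 2 * g * mean2 k m (small y) <= 3 / 2 * g * (5 / 6) by lra.
by rewrite ler_pM2l; lra.
Qed.

End SecondMoment.

Section Exponent.
Variable R : realType.

Definition theta : R := Num.sqrt 2 - 1.

Lemma theta_sqr : (1 + theta) ^+ 2 = 2.
Proof. by rewrite /theta addrC subrK sqr_sqrtr. Qed.

Lemma theta_bounds : 207 / 500 < theta < 1 / 2.
Proof.
have := theta_sqr; have : 0 <= 1 + theta by rewrite /theta addrC subrK sqrtr_ge0.
by move=> h1 h2; apply/andP; split; nra.
Qed.

Lemma powR_nat_unbounded (c M : R) : 0 < c ->
  exists N0, forall N, (N0 <= N)%N -> M <= N%:R `^ c.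
Proof.
move=> c0; have [M0|M0] := leP M 0.
  by exists 0 => N _; exact: le_trans M0 (powR_ge0 _ _).
exists (Num.bound (M `^ c^-1)) => N hN.
have M1 : M `^ c^-1 <= N%:R.
  apply: (@le_trans _ _ (Num.bound (M `^ c^-1))%:R); last by rewrite ler_nat.
  by apply/ltW/archi_boundP/powR_ge0.
have <- : (M `^ c^-1) `^ c = M by rewrite -powRrM mulVf ?gt_eqF// powRr1// ltW.
by apply: ge0_ler_powR => //; rewrite ?nnegrE ?powR_ge0// ltW.
Qed.

(** Splitting according to [x <= kap]. *)
Lemma powR_interpolate (th tau kap x : R) : 0 <= th -> 0 <= tau -> 0 < kap -> 0 < x ->
  x `^ th <= kap `^ th + kap `^ (- tau) * x `^ (th + tau).
Proof.
move=> th0 tau0 kap0 x0.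
have [xk|kx] := leP x kap.
  rewrite -[leLHS]addr0 lerD// ?mulr_ge0 ?powR_ge0//.
  by apply: ge0_ler_powR; rewrite ?nnegrE// ltW.
rewrite -[leLHS]add0r lerD ?powR_ge0// powRD; last by rewrite (gt_eqF x0) implybT.
rewrite mulrCA ler_peMr ?powR_ge0// powRN mulrC ler_pdivlMr ?powR_gt0// mul1r.
by apply: ge0_ler_powR; rewrite ?nnegrE// ltW.
Qed.

Lemma powR_succ_le (c d : R) (N k : nat) : 0 <= d -> (N > 0)%N -> (k <= N)%N ->
  k.+1%:R `^ d <= 2 `^ d * N%:R `^ d :> R.
Proof.
move=> d0 N0 kN; rewrite -powRM//; apply: ge0_ler_powR; rewrite ?nnegrE//.
by rewrite -natrM ler_nat; lia.
Qed.

(** The correction [tau ^ 2] in [a] makes the tilted sum a supermartingale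
    without solving [(1 + a) * (1 + b) = 2], and costs only a second order
    increase of [a + b]. *)
Lemma tilted_exponents (eps : R) : 0 < eps -> exists tau a b : R,
  [/\ 0 < tau < eps, 0 < a, 0 < b < 1, b = theta + tau &
      a + b = 2 * theta + tau ^+ 2 /\ 2 <= (1 + a) * (1 + b)].
Proof.
move=> eps0; have /andP[th0 th1] := theta_bounds; have th2 := theta_sqr.
move: theta th0 th1 th2 => th th0 th1 th2.
have [tau [tau0 taueps tau25]] : exists tau : R, [/\ 0 < tau, tau < eps & tau <= 2 / 5].
  have [e|e] := leP eps (2 / 5); [exists (eps / 2)|exists (2 / 5)]; split; lra.
exists tau, (th - tau + tau ^+ 2), (th + tau).
have sq : 0 <= tau ^+ 2 by exact: sqr_ge0.
split; [by rewrite tau0|by lra|by apply/andP; split; lra|by []|split; first by ring].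
have -> : (1 + (th - tau + tau ^+ 2)) * (1 + (th + tau)) =
    (1 + th) ^+ 2 + th * tau ^+ 2 + tau ^+ 3 by ring.
have q1 : 0 <= th * tau ^+ 2 by rewrite mulr_ge0//; lra.
have q2 : 0 <= tau ^+ 3 by rewrite exprn_ge0// ltW.
by rewrite th2 -addrA lerDl addr_ge0.
Qed.

(** The threshold between small and large sizes is [kap = N ^ eps]. Small pairs
    cost [N ^ (eps * theta + s) = N ^ (2 * theta - eps * (1 - theta))], large
    ones [N ^ (2 * theta + tau ^ 2 - eps * tau)]; both are negligible compared
    with the mean, of order [N ^ (2 * theta)]. *)
Lemma common_large_positive_probability (delta s : R) : 0 < delta -> s < 2 * theta ->
  exists N0, forall N k m : nat, (N0 <= N)%N ->
    (k <= N)%N -> (m <= N)%N ->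
    delta * N%:R <= k%:R -> delta * N%:R <= m%:R ->
    mean2 k m (small ((N%:R : R) `^ s)) <= 5 / 6.
Proof.
move=> delta0; rewrite -subr_gt0 => s2.
have [eps [epsE eps0]] : exists eps, 2 * theta - s = eps /\ 0 < eps.
  by exists (2 * theta - s).
have [tau [a [b [/andP[tau0 taueps] a0 /andP[b0 b1] bE [abE ab]]]]] :=
  tilted_exponents eps0.
have [thge0 th01 th1] : [/\ 0 <= theta, 0 < theta < 1 & 0 < 1 - theta].
  by have /andP[th0 th1] := theta_bounds; split; [lra|apply/andP; split; lra|lra].
have etau0 : 0 < eps - tau by rewrite subr_gt0.
pose D : R := delta `^ (2 * theta) / 4.
have D0 : 0 < D by rewrite divr_gt0// powR_gt0.
pose C1 : R := expR theta.
pose C2 : R := 2 * expR theta * (expR a * 2 `^ a) * (expR b * 2 `^ b).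
have e1 : 0 < eps * (1 - theta) by rewrite mulr_gt0.
have e2 : 0 < tau * (eps - tau) by rewrite mulr_gt0.
have [N1 hN1] := powR_nat_unbounded (C1 / D) e1.
have [N2 hN2] := powR_nat_unbounded (C2 / D) e2.
exists (maxn 1 (maxn N1 N2)) => N k m; rewrite !geq_max => /and3P[N0 /hN1 h1 /hN2 h2].
move=> kN mN dk dm.
have N0' : 0 < N%:R :> R by rewrite ltr0n.
have NN c d : N%:R `^ (c + d) = N%:R `^ c * N%:R `^ d :> R.
  by rewrite powRD// (gt_eqF N0') implybT.
pose kap : R := N%:R `^ eps; have kap0 : 0 < kap by rewrite powR_gt0.
pose A : R := expR theta * kap `^ theta.
pose L : R := expR theta * kap `^ (- tau).
have A0 : 0 <= A by rewrite mulr_ge0 ?expR_ge0 ?powR_ge0.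
have L0 : 0 <= L by rewrite mulr_ge0 ?expR_ge0 ?powR_ge0.
pose g := growth theta k * growth theta m.
have gD : D * N%:R `^ (2 * theta) <= g / 4.
  rewrite /D mulrAC ler_pM2r ?invr_gt0// -powRM ?(ltW delta0) ?ler0n//.
  rewrite mulr_natl mulr2n powRD; last by rewrite (gt_eqF (mulr_gt0 delta0 N0')) implybT.
  have lb i : delta * N%:R <= i%:R -> (delta * N%:R) `^ theta <= growth theta i.
    move=> di; apply: le_trans (growth_ge_powR i th01).
    apply: ge0_ler_powR; rewrite ?nnegrE ?mulr_ge0 ?(ltW delta0) ?ler0n//.
    by apply: le_trans di _; rewrite ler_nat.
  by rewrite ler_pM ?powR_ge0// lb.
apply: (@second_moment_bound _ k m g A _ (stopped_sum theta theta)
  (fun t t' => L * (stopped_sum a b t t' + stopped_sum b a t t'))).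
- by rewrite mulr_gt0// (lt_le_trans ltr01)// growth_ge1.
- by [].
- apply: le_trans gD; rewrite /A /kap -powRrM -mulrA -NN.
  have -> : 2 * theta = (eps * (1 - theta)) + (eps * theta + s) by rewrite -epsE; ring.
  by rewrite [leRHS]mulrC (NN (eps * (1 - theta))) mulrAC ler_wpM2r ?powR_ge0// -ler_pdivrMr.
- move=> t t'; rewrite mulr_ge0// addr_ge0// stopped_sum_ge0// ltW//.
- move=> t t'; apply: stopped_sum_le_common => //; try exact: ltW.
  move=> j; apply: (le_trans (growth_le_powR j thge0)).
  rewrite /A /L -!mulrA -mulrDr ler_wpM2l ?expR_ge0//.
  apply: (le_trans (@powR_interpolate _ tau kap _ thge0 (ltW tau0) kap0 _)); first by rewrite ltr0n.
  by rewrite lerD2l ler_wpM2l ?powR_ge0// -bE growth_ge_powR// b0.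
- by rewrite mean_stopped_sum// theta_sqr.
- by rewrite mean_stopped_sum_sqr// theta_sqr.
rewrite mean2Z mean2D.
have ub i j : (i <= N)%N -> (j <= N)%N -> growth a i * growth b j <=
    (expR a * 2 `^ a) * (expR b * 2 `^ b) * N%:R `^ (2 * theta + tau ^+ 2).
  move=> iN jN; rewrite -abE.
  rewrite NN mulrACA; apply: ler_pM; try by rewrite (le_trans ler01)// growth_ge1// ltW.
  - apply: (le_trans (growth_le_powR i (ltW a0))).
    by rewrite -mulrA ler_wpM2l ?expR_ge0// powR_succ_le// ltW.
  - apply: (le_trans (growth_le_powR j (ltW b0))).
    by rewrite -mulrA ler_wpM2l ?expR_ge0// powR_succ_le// ltW.
apply: (@le_trans _ _ (C2 * N%:R `^ (2 * theta - tau * (eps - tau)))).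
  have -> : 2 * theta - tau * (eps - tau) = eps * (- tau) + (2 * theta + tau ^+ 2) by ring.
  rewrite NN [N%:R `^ (eps * _)]powRrM -/kap.
  have m1 := mean_stopped_sum_le k m (ltW a0) (ltW b0) ab.
  have m2 : mean2 k m (stopped_sum b a) <= growth b k * growth a m.
    by apply: mean_stopped_sum_le; [exact: ltW|exact: ltW|rewrite mulrC].
  have m2' := le_trans m2 (eq_ind_r (fun x => x <= _) (ub m k mN kN) (mulrC _ _)).
  apply: le_trans (ler_wpM2l L0 (lerD (le_trans m1 (ub k m kN mN)) m2')) _.
  by rewrite /L /C2 le_eqVlt; apply/orP; left; apply/eqP; ring.
apply: le_trans gD; rewrite NN powRN mulrCA [leRHS]mulrC ler_wpM2l ?powR_ge0//.
by rewrite ler_pdivrMr ?powR_gt0// mulrC -ler_pdivrMr.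
Qed.

End Exponent.

(** * Amplification of the probability *)

Section Bootstrap.
Variable R : realType.

(** The bound is required for every ratio [delta] at once, since the
    amplification step shrinks the trees by a constant factor. *)
Definition small_bounded_by (x : R) : Prop :=
  forall delta s : R, 0 < delta -> s < 2 * theta R ->
  exists N0, forall N k m : nat, (N0 <= N)%N -> (k <= N)%N -> (m <= N)%N ->
    delta * N%:R <= k%:R -> delta * N%:R <= m%:R ->
    mean2 k m (small ((N%:R : R) `^ s)) <= x.

Lemma count_small_indices (n : nat) (z : R) : 0 <= z ->
  \sum_(i < n) ((i%:R < z)%R : bool)%:R <= z + 1.
Proof.
move=> z0; have le_n p : \sum_(i < p) ((i%:R < z)%R : bool)%:R <= p%:R :> R.
  rewrite -[p in leRHS]card_ord -sum1_card natr_sum; apply: ler_sum => i _.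
  by case: (_ < _).
elim: n => [|n IH]; first by rewrite big_ord0; lra.
rewrite big_ord_recr /=; case: ltP => nz /=; last by rewrite addr0.
by have := le_n n; lra.
Qed.

(** The sum of two nonnegative terms is small only if both are. *)
Lemma small_Node (y : R) l r l' r' :
  small y (Node l r) (Node l' r') <= small y l l' * small y r r'.
Proof.
have lrD : (common l l' + common r r')%:R = (common l l')%:R + (common r r')%:R :> R.
  by rewrite natrD.
have l0 : 0 <= (common l l')%:R :> R by [].
have r0 : 0 <= (common r r')%:R :> R by [].
rewrite /small /= lrD.
by case: ltP => h1; case: ltP => h2; case: ltP => h3; rewrite /= ?mulr1 ?mul0r//; lra.
Qed.

Lemma mean_small_branch (y : R) k m :
  mean2 k.+1 m.+1 (small y) <=
  avg2 k m (fun i j => mean2 i j (small y) * mean2 (k - i) (m - j) (small y)).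
Proof.
rewrite mean2_split; apply: ler_avg2 => i j _ _.
rewrite mulrC -mean2Z; apply: ler_mean2 => l l'.
by rewrite mulrC -mean2Z; apply: ler_mean2 => r r'; exact: small_Node.
Qed.

(** For large [N], the four pieces of a uniform split all have size at least
    [delta * eta / 8 * N] except with probability [eta], a single piece being
    too small with probability at most [eta / 4]. When none is, the two
    independent pairs of pieces must both fail, each with probability at most
    [x]. *)
Lemma small_bounded_by_step (x eta : R) : 0 <= x -> 0 < eta ->
  small_bounded_by x -> small_bounded_by (x ^+ 2 + eta).
Proof.
move=> x0 eta0 hx delta s delta0 s2.
pose delta' := delta * eta / 8.
have delta'0 : 0 < delta' by rewrite divr_gt0// mulr_gt0.
have [N1 hN1] := hx delta' s delta'0 s2.
have [N2 hN2] := powR_nat_unbounded (8 / (delta * eta)) (@ltr01 R).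
exists (maxn 1 (maxn N1 N2)) => N k m; rewrite !geq_max => /and3P[N0 /hN1 h1 /hN2 h2].
have N0' : 0 < N%:R :> R by rewrite ltr0n.
have dN : 0 < delta * N%:R by rewrite mulr_gt0.
move=> kN mN dk dm.
have : (0 < k)%N by rewrite -(ltr0n R); lra.
have : (0 < m)%N by rewrite -(ltr0n R); lra.
case: k kN dk => // k kN dk; case: m mN dm => // m mN dm _ _.
apply: le_trans (mean_small_branch _ _ _) _.
pose y : R := N%:R `^ s; pose p i j := mean2 i j (small y).
have p1 i j : 0 <= p i j <= 1 by rewrite mean_small_ge0 mean_small_le1.
pose bad (i : nat) : R := (((i%:R : R) < delta' * N%:R)%R : bool)%:R.
have bad0 i : 0 <= bad i by [].
have bad1 (i : nat) : (i%:R : R) < delta' * N%:R -> bad i = 1 by rewrite /bad => ->.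
have key i j : (i <= k)%N -> (j <= m)%N ->
  p i j * p (k - i)%N (m - j)%N <=
  x ^+ 2 + ((bad i + bad (k - i)%N) * 1 + 1 * (bad j + bad (m - j)%N)).
  move=> ik jm; rewrite mulr1 mul1r.
  have /andP[p0 p1'] := p1 i j; have /andP[q0 q1] := p1 (k - i)%N (m - j)%N.
  have pq1 : p i j * p (k - i)%N (m - j)%N <= 1 by rewrite mulr_ile1.
  have := (bad0 i, bad0 (k - i)%N, bad0 j, bad0 (m - j)%N, sqr_ge0 x).
  move=> [[[[]]]] b1 b2 b3 b4 xx.
  have [/bad1 e|i1] := ltP (i%:R : R) (delta' * N%:R); first by rewrite e in b1 *; lra.
  have [/bad1 e|i2] := ltP ((k - i)%:R : R) (delta' * N%:R); first by rewrite e in b2 *; lra.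
  have [/bad1 e|j1] := ltP (j%:R : R) (delta' * N%:R); first by rewrite e in b3 *; lra.
  have [/bad1 e|j2] := ltP ((m - j)%:R : R) (delta' * N%:R); first by rewrite e in b4 *; lra.
  have kN' := ltnW kN; have mN' := ltnW mN.
  have A : p i j <= x.
    by apply: h1 i1 j1; [exact: leq_trans kN'|exact: leq_trans mN'].
  have B : p (k - i)%N (m - j)%N <= x.
    by apply: h1 i2 j2; apply: leq_trans (leq_subr _ _) _.
  by have := ler_pM p0 q0 A B; rewrite -expr2; lra.
apply: le_trans (ler_avg2 key) _.
have avg_bad n : (n <= N)%N -> delta * N%:R <= n.+1%:R ->
   n.+1%:R^-1 * (\sum_(i < n.+1) (bad i + bad (n - i)%N)) <= eta / 2.
  move=> nN dn; rewrite big_split /=.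
  have -> : \sum_(i < n.+1) bad (n - i)%N = \sum_(i < n.+1) bad i.
    by rewrite [RHS](reindex_inj rev_ord_inj); apply: eq_bigr.
  have B : \sum_(i < n.+1) bad i <= delta' * N%:R + 1.
    by apply: count_small_indices; rewrite mulr_ge0// ltW.
  have n0 : 0 < n.+1%:R :> R by rewrite ltr0n.
  rewrite ler_pdivrMl//.
  have : 8 <= delta * eta * N%:R.
    by move: h2; rewrite powRr1// ler_pdivrMr ?mulr_gt0// mulrC.
  have : delta * N%:R * eta <= n.+1%:R * eta by rewrite ler_wpM2r// ltW.
  move: B; rewrite /delta'; lra.
have one n : n.+1%:R^-1 * \sum_(i < n.+1) (1 : R) = 1.
  by rewrite sumr_const card_ord mulVf// pnatr_eq0.
rewrite avg2D avg2_cst avg2D !avg2_prod !one mulr1 mul1r lerD2l.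
apply: le_trans (lerD (avg_bad k (ltnW kN) dk) (avg_bad m (ltnW mN) dm)) _; lra.
Qed.

Lemma small_bounded_by_le (x x' : R) :
  x <= x' -> small_bounded_by x -> small_bounded_by x'.
Proof.
move=> xx' hx delta s delta0 s2; have [N0 h] := hx delta s delta0 s2.
by exists N0 => N k m h1 h2 h3 h4 h5; apply: le_trans (h _ _ _ h1 h2 h3 h4 h5) xx'.
Qed.

(** The map [x -> x ^ 2 + x / 12] contracts by 11/12 below 5/6. *)
Lemma small_bounded_by_pos (x : R) : 0 < x -> small_bounded_by x.
Proof.
move=> x0.
have geo n : small_bounded_by (5 / 6 * (11 / 12) ^+ n).
  elim: n => [|n IH].
    rewrite expr0 mulr1 => delta s delta0 s2.
    exact: common_large_positive_probability.
  set z := 5 / 6 * _ in IH; have q0 : 0 < (11 / 12 : R) ^+ n by rewrite exprn_gt0//; lra.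
  have z0 : 0 < z by rewrite /z mulr_gt0//; lra.
  have q1 : (11 / 12 : R) ^+ n <= 1 by rewrite exprn_ile1//; lra.
  have z1 : z <= 5 / 6 by rewrite /z; lra.
  have z12 : 0 < z / 12 by lra.
  apply: small_bounded_by_le (small_bounded_by_step (ltW z0) z12 IH).
  rewrite [in leRHS]exprS [leRHS]mulrCA -/z expr2.
  have : z * z <= z * (5 / 6) by rewrite ler_wpM2l// ltW.
  clearbody z; lra.
have : (11 / 12 : R) ^+ n @[n --> \oo] --> (0 : R).
  by apply: cvg_expr; rewrite ger0_norm; lra.
move=> /cvgr0_norm_lt /(_ _ x0) [n _ /(_ n (leqnn _))] /= h.
apply: small_bounded_by_le (geo n).
have q0 : 0 < (11 / 12 : R) ^+ n by rewrite exprn_gt0//; lra.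
move: h; rewrite gtr0_norm//; lra.
Qed.

Lemma mean_small_diagonal (x s : R) : 0 < x -> s < 2 * theta R ->
  exists N0, forall N : nat, (N0 <= N)%N ->
    mean2 N N (small ((N.+1%:R : R) `^ s)) <= x.
Proof.
move=> x0 s2; have h2 : 0 < 2^-1 :> R by rewrite invr_gt0.
have [N0 h] := small_bounded_by_pos x0 h2 s2.
exists (maxn 1 N0) => N; rewrite geq_max => /andP[N1 NN0].
have half : 2^-1 * N.+1%:R <= N%:R :> R.
  have : 1 <= N%:R :> R by rewrite ler1n.
  by rewrite -[N.+1%:R]natr1; lra.
by apply: h => //; exact: leqW.
Qed.

End Bootstrap.

(** * Transfer to the random trees *)

Section AttachmentSequences.
Local Open Scope nat_scope.

Fixpoint attachment_seqs (k : nat) : seq (seq nat) :=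
  if k is k'.+1 then [seq rcons s j | s <- attachment_seqs k', j <- iota 0 k'.+1]
  else [:: [::]].

Lemma mem_attachment_seqs k s : s \in attachment_seqs k ->
  size s = k /\ forall j, j < k -> nth 0 s j <= j.
Proof.
elim: k s => [|k IH] s; first by rewrite inE => /eqP->.
move=> /allpairsP[[s' j] [/= /IH[sk hs] jk ->]]; rewrite size_rcons sk; split=> // i.
rewrite ltnS leq_eqVlt nth_rcons sk => /predU1P[->|ik]; last by rewrite ik hs.
by rewrite ltnn eqxx; move: jk; rewrite -[_ :: _]/(iota 0 k.+1) mem_iota.
Qed.

Lemma uniq_attachment_seqs k : uniq (attachment_seqs k).
Proof.
elim: k => // k IH; apply: (@allpairs_uniq _ _ _ rcons) => //; first exact: iota_uniq.
by move=> [s i] [s' j] _ _ /= /rcons_inj[-> ->].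
Qed.

Lemma eq_build u v k : (forall j, j < k -> u j = v j) -> build u k = build v k.
Proof.
elim: k => //= k IH uv; rewrite uv// IH// => j jk.
by rewrite uv// ltnW.
Qed.

(** Choosing a leaf uniformly amounts to choosing uniformly among the splits of
    the shape. *)
Lemma splits_unlabel w t : uniq (leaves t) ->
  [seq unlabel (grow v w t) | v <- leaves t] = splits (unlabel t).
Proof.
elim: t => [a|l IHl r IHr] /=; first by rewrite eqxx.
rewrite cat_uniq => /and3P[ul /hasPn lr ur]; rewrite map_cat -IHl// -IHr// -!map_comp.
congr (_ ++ _); apply/eq_in_map => v vl /=.
  by rewrite (@grow_notin _ _ r)//; apply: contraL vl => /lr.
by rewrite (@grow_notin _ _ l)//; apply: lr.
Qed.

End AttachmentSequences.

Section Shapes.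
Variable R : realType.

Lemma sum_attachment_seqs k (F : shape_tree -> R) :
  \sum_(s <- attachment_seqs k) F (unlabel (build (nth 0%N s) k)) =
  \sum_(t <- shapes k) F t.
Proof.
elim: k F => [|k IH] F; first by rewrite !big_seq1.
rewrite [RHS]big_flatten big_map -(IH (fun t => \sum_(t' <- splits t) F t')).
rewrite big_allpairs_dep big_seq_cond [RHS]big_seq_cond; apply: eq_bigr => s /andP[sk _].
have [szs hs] := mem_attachment_seqs sk.
have pl := leaves_build hs.
rewrite -(@splits_unlabel k.+1); last by rewrite (perm_uniq pl) iota_uniq.
rewrite big_map (perm_big _ pl); apply: eq_bigr => j _.
rewrite /= nth_rcons szs ltnn eqxx; congr (F (unlabel (grow _ _ _))).
by apply: eq_build => i ik; rewrite nth_rcons szs ik.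
Qed.

Lemma mean2_attachment_seqs k (H : shape_tree -> shape_tree -> R) :
  mean2 k k H = \sum_(s <- attachment_seqs k) \sum_(s' <- attachment_seqs k)
    ((k`!%:R)^-1 * (k`!%:R)^-1) *
    H (unlabel (build (nth 0%N s) k)) (unlabel (build (nth 0%N s') k)).
Proof.
rewrite /mean2 /mean -[in LHS]sum_attachment_seqs mulr_sumr; apply: eq_bigr => s _.
by rewrite -sum_attachment_seqs -mulr_sumr mulrA.
Qed.

End Shapes.

(** The graph on [n] vertices reads only the first [n.-1] attachments. *)
Lemma eq_attachment_tree u v n : (forall j, (j < n.-1)%N -> u j = v j) ->
  attachment_tree u n = attachment_tree v n.
Proof.
move=> uv; have e : @attachment_rel u n = @attachment_rel v n.
  apply/funext => x; apply/funext => y; rewrite /attachment_rel.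
  have lt_pred (a b : 'I_n) : (a < b)%N -> u b.-1 = v b.-1.
    by move=> ab; apply: uv; have := ltn_ord b; lia.
  by congr (_ || _); apply: andb_id2l => /lt_pred->.
rewrite /attachment_tree; move: (attachment_rel_sym u (n := n)) (attachment_rel_irr u (n := n)).
rewrite e => p q; congr Graph; exact: Prop_irrelevance.
Qed.

Section Law.
Variables (R : realType) (d : measure_display) (Omega : measurableType d).
Variables (P : probability Omega R) (U : bool * nat -> {RV P >-> nat}).
Hypothesis hU : independent_uniform_attachments U.

Definition prefix_event (k : nat) (p : seq nat * seq nat) : set Omega :=
  [set w | forall j, (j < k)%N ->
     U (false, j) w = nth 0%N p.1 j /\ U (true, j) w = nth 0%N p.2 j].

Definition prefix_index (k : nat) : seq (bool * nat) :=
  [seq (b, j) | b <- [:: false; true], j <- iota 0 k].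

Definition prefix_value (p : seq nat * seq nat) (i : bool * nat) : set nat :=
  [set nth 0%N (if i.1 then p.2 else p.1) i.2].

Lemma prefix_eventE k p : prefix_event k p =
  [set w | forall i, i \in prefix_index k -> prefix_value p i (U i w)].
Proof.
apply/seteqP; split=> w /= h.
  move=> [b j] /allpairsP[[b' j'] [_ /= jk [-> ->]]].
  move: jk; rewrite mem_iota => /h[h1 h2].
  by case: b' => /=.
move=> j jk.
have mj b : (b, j) \in prefix_index k.
  by apply/allpairsP; exists (b, j); split; rewrite ?mem_iota//; case: b.
by split; [exact: (h _ (mj false))|exact: (h _ (mj true))].
Qed.

Lemma prefix_event_bigcap k p : prefix_event k p =
  \bigcap_(j in [set j | (j < k)%N])
    ((U (false, j) @^-1` [set nth 0%N p.1 j]) `&` (U (true, j) @^-1` [set nth 0%N p.2 j])).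
Proof. by []. Qed.

Lemma measurable_prefix_event k p : measurable (prefix_event k p).
Proof.
rewrite prefix_event_bigcap; apply: bigcap_measurableType => j _.
by apply: measurableI; apply: measurable_funPTI.
Qed.

Lemma prefix_event_prob k p :
  p.1 \in attachment_seqs k -> p.2 \in attachment_seqs k ->
  P (prefix_event k p) = ((k`!%:R)^-1 * (k`!%:R)^-1)%:E.
Proof.
move=> /mem_attachment_seqs[_ h1] /mem_attachment_seqs[_ h2].
rewrite prefix_eventE; case: hU => indep unif.
rewrite indep; last 2 first.
- apply: allpairs_uniq; rewrite ?iota_uniq//.
  by move=> [b j] [b' j'] _ _ /= [-> ->].
- by [].
rewrite big_allpairs_dep !big_cons big_nil /= mule1.
have half b (s : seq nat) : (forall j, (j < k)%N -> (nth 0%N s j <= j)%N) ->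
   (\prod_(j <- iota 0 k) P (U (b, j) @^-1` [set nth 0%N s j]) = ((k`!%:R)^-1)%:E)%E.
  elim: k {h1 h2} => [|k IH] hs; first by rewrite big_nil invr1.
  rewrite -[k.+1]addn1 iotaD big_cat /= big_seq1 add0n IH; last first.
    by move=> j jk; apply: hs; exact: ltnW.
  have := unif b k (nth 0%N s k) (hs k (ltnSn k)); rewrite /distribution /pushforward => ->.
  by rewrite addn1 -EFinM factS natrM invfM mulrC.
by rewrite !half// EFinM.
Qed.

(** An event determined by finitely many integers is a countable union of
    prefix events. *)
Lemma measurable_prefix_determined k (Q : set Omega) :
  (forall w w', (forall b j, (j < k)%N -> U (b, j) w = U (b, j) w') -> Q w -> Q w') ->
  measurable Q.
Proof.
move=> hQ; pose pre (w : Omega) := (mkseq (fun j => U (false, j) w) k, mkseq (fun j => U (true, j) w) k).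
have -> : Q = \bigcup_(p in pre @` Q) prefix_event k p.
  apply/seteqP; split=> w.
    move=> Qw; exists (pre w); first by exists w.
    by move=> j jk; rewrite /= !nth_mkseq.
  move=> [_ [w' Qw' <-] h]; apply: hQ Qw' => b j jk.
  by have [] := h j jk; rewrite /= !nth_mkseq//; case: b.
rewrite bigcup_mkcond; apply: countable_bigcupT_measurable => [|p]; first exact: countableP.
by case: ifP => _; [exact: measurable_prefix_event|exact: measurable0].
Qed.

(** An inequality is enough here, and it avoids describing the null event on
    which some attachment exceeds its range. *)
Lemma prob_ge_mean k (Q : set Omega) (G : shape_tree -> shape_tree -> bool) :
  measurable Q ->
  (forall u u', (forall j, (j < k)%N -> (u j <= j)%N) ->
                (forall j, (j < k)%N -> (u' j <= j)%N) ->
    G (unlabel (build u k)) (unlabel (build u' k)) ->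
    forall w, (forall j, (j < k)%N -> U (false, j) w = u j /\ U (true, j) w = u' j) -> Q w) ->
  ((mean2 k k (fun t t' => (G t t')%:R))%:E <= P Q)%E.
Proof.
move=> mQ hQ.
pose good (p : seq nat * seq nat) :=
  G (unlabel (build (nth 0%N p.1) k)) (unlabel (build (nth 0%N p.2) k)).
pose D := [seq p <- [seq (s, s') | s <- attachment_seqs k, s' <- attachment_seqs k] | good p].
have memD p : p \in D -> [/\ p.1 \in attachment_seqs k, p.2 \in attachment_seqs k & good p].
  by rewrite mem_filter => /andP[gp /allpairsP[[s s'] [/= h h' e]]]; rewrite e in gp *.
have uD : uniq D.
  rewrite filter_uniq// allpairs_uniq ?uniq_attachment_seqs//.
  by move=> [s i] [s' j] _ _ /= [-> ->].
have -> : (mean2 k k (fun t t' => (G t t')%:R))%:E = P (\bigcup_(p in [set` D]) prefix_event k p).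
  rewrite measure_fin_bigcup; first last.
  - by move=> p _; exact: measurable_prefix_event.
  - move=> p q /= /memD[p1 p2 _] /memD[q1 q2 _] [w [hp hq]].
    have [sp1 _] := mem_attachment_seqs p1; have [sp2 _] := mem_attachment_seqs p2.
    have [sq1 _] := mem_attachment_seqs q1; have [sq2 _] := mem_attachment_seqs q2.
    rewrite [p]surjective_pairing [q]surjective_pairing; congr (_, _).
      apply: (@eq_from_nth _ 0%N) => [|j]; rewrite sp1 ?sq1// => jk.
      by have [<- _] := hp _ jk; have [<- _] := hq _ jk.
    apply: (@eq_from_nth _ 0%N) => [|j]; rewrite sp2 ?sq2// => jk.
    by have [_ <-] := hp _ jk; have [_ <-] := hq _ jk.
  - exact: finite_seq.
  rewrite -fsbig_seq// mean2_attachment_seqs.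
  rewrite (eq_big_seq (fun=> ((k`!%:R)^-1 * (k`!%:R)^-1)%:E)); last first.
    by move=> p /memD[p1 p2 _]; exact: prefix_event_prob.
  rewrite sumEFin; congr (_%:E); rewrite big_filter [RHS]big_mkcond big_allpairs_dep.
  apply: eq_bigr => s _; apply: eq_bigr => s' _ /=.
  by rewrite /good /=; case: (G _ _); rewrite ?mulr1 ?mulr0.
apply: le_measure; rewrite ?inE//.
  apply: fin_bigcup_measurable => // p _; exact: measurable_prefix_event.
move=> w [p /memD[p1 p2 gp] hp].
have [_ h1] := mem_attachment_seqs p1; have [_ h2] := mem_attachment_seqs p2.
exact: hQ gp _ hp.
Qed.

Lemma cvg_prob1 (A : nat -> set Omega) :
  (forall n, measurable (A n)) ->
  (forall x : R, 0 < x -> exists N0, forall n, (N0 <= n)%N -> ((1 - x)%:E <= P (A n))%E) ->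
  P (A n) @[n --> \oo] --> 1%E.
Proof.
move=> mA hA; apply: cvg_EFin.
  by near=> n; exact: fin_num_measure.
apply/cvgrPdist_le => /= x x0; have [N0 hN0] := hA x x0.
near=> n; have nN : (N0 <= n)%N by near: n; exact: nbhs_infty_ge.
have := hN0 n nN; have := probability_le1 P (mA n).
have : P (A n) \is a fin_num by exact: fin_num_measure.
case: (P (A n)) => // y _; rewrite !lee_fin /= => y1 xy.
by rewrite ger0_norm; lra.
Unshelve. all: by end_near.
Qed.

End Law.

Theorem corollary4p2 (R : realType) (d : measure_display)
    (Omega : measurableType d) (P : probability Omega R)
    (U : bool * nat -> {RV P >-> nat})
    (hU : independent_uniform_attachments U) :
  let X (n : nat) (w : Omega) : nat :=
    largest_common_subtree_size
      (attachment_tree (fun k => U (false, k) w) n)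
      (attachment_tree (fun k => U (true, k) w) n) in
  (forall eps : R, 0 < eps ->
    P [set w | (n%:R : R) `^ (2 * (Num.sqrt 2 - 1) - eps) <= (X n w)%:R]
      @[n --> \oo] --> 1%E) /\
  (P [set w | (n%:R : R) `^ (828 / 1000) <= (X n w)%:R] @[n --> \oo] --> 1%E).
Proof.
move=> X.
suff main (s : R) : s < 2 * theta R ->
    P [set w | (n%:R : R) `^ s <= (X n w)%:R] @[n --> \oo] --> 1%E.
  split=> [eps eps0|]; apply: main; first by rewrite /theta; lra.
  by have /andP[] := theta_bounds R; lra.
move=> s2.
have mX n : measurable [set w | (n%:R : R) `^ s <= (X n w)%:R].
  apply: (@measurable_prefix_determined _ _ _ _ U n.-1) => w w' ww' /=.
  have e b : attachment_tree (fun k => U (b, k) w) n = attachment_tree (fun k => U (b, k) w') n.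
    by apply: eq_attachment_tree => j; exact: ww'.
  by rewrite /X !e.
apply: cvg_prob1 => // x x0; have [N0 hN0] := mean_small_diagonal x0 s2.
exists N0.+1 => -[//|k] kN.
pose G (t t' : shape_tree) := ~~ ((common t t')%:R < (k.+1%:R : R) `^ s).
have mG : mean2 k k (fun t t' => (G t t')%:R) =
    1 - mean2 k k (small ((k.+1%:R : R) `^ s)).
  rewrite -mulN1r -mean2Z -[X in _ = X + _](mean2_cst k k) -mean2D; apply: eq_mean2 => t t' _ _.
  by rewrite /small /G; case: ltP => _ /=; lra.
apply: (@le_trans _ _ (mean2 k k (fun t t' => (G t t')%:R))%:E).
  by rewrite mG lee_fin lerD2l lerN2 hN0.
apply: (prob_ge_mean hU) => // u u' hu hu' Guu' w hw /=.
have eb b v : (forall j, (j < k)%N -> U (b, j) w = v j) ->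
    attachment_tree (fun j => U (b, j) w) k.+1 = attachment_tree v k.+1.
  by move=> h; apply: eq_attachment_tree.
rewrite /X (eb false u) ?(eb true u'); try by move=> j /hw[].
move: Guu'; rewrite /G -leNgt common_unlabel => /le_trans; apply.
by rewrite ler_nat common_le_largest_common_subtree.
Qed.
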